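(* Let $\zeta_1,\dots,\zeta_r\in\mathbb{C}^\times$ satisfy $\prod_{i=1}^r\zeta_i^{a_{ij}}\notin q^{\mathbb Z}$ for all $j=1,\dots,r$, and let $\Lambda_1(z),\dots,\Lambda_r(z)$ be monic polynomials. There is a bijection between the set of nondegenerate polynomial solutions $\{Q^i_+(z),Q^i_-(z)\}_{i=1,\dots,r}$ of the $QQ$-system $$\widetilde\xi_i\,Q^i_-(z)Q^i_+(qz)-\xi_i\,Q^i_-(qz)Q^i_+(z)=\Lambda_i(z)\prod_{j>i}\big[Q^j_+(qz)\big]^{-a_{ji}}\prod_{j<i}\big[Q^j_+(z)\big]^{-a_{ji}},\quad i=1,\dots,r,$$ where $\widetilde\xi_i=\zeta_i\prod_{j>i}\zeta_j^{a_{ji}}$ and $\xi_i=\zeta_i^{-1}\prod_{j<i}\zeta_j^{-a_{ji}}$, and the set of nondegenerate polynomial solutions $\{Q^i_+(z)\}_{i=1,\dots,r}$ of the Bethe Ansatz equations $$\frac{Q_+^{i}(qw_i^k)}{Q_+^{i}(q^{-1}w_i^k)}\prod_j\zeta_j^{a_{ji}}=-\frac{\Lambda_i(w_i^k)\prod_{j>i}\big[Q^j_+(qw_i^k)\big]^{-a_{ji}}\prod_{j<i}\big[Q^j_+(w_i^k)\big]^{-a_{ji}}}{\Lambda_i(q^{-1}w_i^k)\prod_{j>i}\big[Q^j_+(w_i^k)\big]^{-a_{ji}}\prod_{j<i}\big[Q^j_+(q^{-1}w_i^k)\big]^{-a_{ji}}},\quad i=1,\dots,r,\ k=1,\dots,m_i,$$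 where $\{w_i^k\}_{k=1,\dots,m_i}$ is the set of roots of the polynomial $Q^i_+(z)$.
   Context: $q\in\mathbb{C}^\times$ is not a root of unity. $G$ is a simply connected simple complex Lie group of rank $r$ with simple roots $\alpha_i$, coroots $\check\alpha_i$ and Cartan matrix $a_{ij}=\langle\alpha_j,\check\alpha_i\rangle$. A total ordering of the simple roots is fixed, and $j<i$ (resp. $j>i$) means that $\alpha_j$ precedes (resp. follows) $\alpha_i$ in this ordering. Numbers $v,w\in\mathbb{C}^\times$ are called $q$-distinct if $q^{\mathbb Z}v\cap q^{\mathbb Z}w=\varnothing$. Nondegeneracy of a polynomial solution $\{Q^i_+,Q^i_-\}_{i=1,\dots,r}$ of the $QQ$-system means: $\prod_{i}\zeta_i^{a_{ij}}\notin q^{\mathbb Z}$ for all $j$; for all $i,j,k$ with $i\neq j$ and $a_{ik}\ne0$, $a_{jk}\ne0$, the zeros of $Q^i_+(z)$ and $Q^j_+(z)$ are $q$-distinct from each other and from the zeros of $\Lambda_k(z)$ (for $r=1$: the roots of $Q_+(z)$ are $q$-distinct from the roots of $\Lambda(z)$); and the polynomials $Q^i_+(z)$ are monic. The same notion is applied to solutions $\{Q^i_+\}_{i=1,\dots,r}$ of the Bethe Ansatz equations.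
   Formalization: The bijection is proved between solutions whose Q_+^i all have simple roots (false otherwise: SL(2), q=2, ζ²=3, Λ=z-1, Q_+=(z-13/7)²); on all nondegenerate solutions, forgetting Q_- is shown to be an injective map into Bethe solutions. Bethe denominators are required to be nonzero. *)

(* Defs.v *)
From mathcomp Require Import all_boot all_order all_algebra.
From mathcomp Require Import boolp classical_sets functions reals.
From mathcomp Require Import complex.

Set Implicit Arguments.
Unset Strict Implicit.
Unset Printing Implicit Defensive.

Import Order.TTheory GRing.Theory Num.Theory.
Local Open Scope ring_scope.

(* The Cartan matrix of a simple complex Lie group of rank r.  The rows of
   alpha are the simple roots alpha_i in Euclidean space R^r, so that
   (alpha *m alpha^T) i j = (alpha_i, alpha_j), the coroot of alpha_i is
   2 alpha_i / (alpha_i, alpha_i), and a i j is the value of alpha_j on it.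
   Such matrices (integral, nonpositive off the diagonal, indecomposable) are
   the Cartan matrices of the irreducible reduced root systems, which classify
   the simply connected simple complex Lie groups. *)
Definition simple_cartan_matrix (R : realType) (r : nat) (a : 'M[int]_r) :=
  [/\ (0 < r)%N,
      exists2 alpha : 'M[R]_r, alpha \in unitmx
        & forall i j, (a i j)%:~R
            = 2 * (alpha *m alpha^T) i j / (alpha *m alpha^T) i i,
      forall i j, i != j -> a i j <= 0
    & forall S : {set 'I_r}, (0 < #|S| < r)%N ->
        exists i j, [/\ i \in S, j \notin S & a i j != 0] ].

(* [prec j i] stands for j < i in the chosen ordering of the simple roots. *)
Definition strict_total_order (T : eqType) (prec : rel T) :=
  [/\ irreflexive prec, transitive prec
    & forall i j, i != j -> prec i j || prec j i].

Section QQ.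

Variables (R : realType) (r : nat) (a : 'M[int]_r) (prec : rel 'I_r).
Variables (q : R[i]) (zeta : 'I_r -> R[i]) (Lambda : 'I_r -> {poly R[i]}).

Implicit Types Qp Qm : 'I_r -> {poly R[i]}.

(* This is used on arbitrary complex numbers: 0 is q-distinct from every
   nonzero number and not q-distinct from itself. *)
Definition q_distinct (v w : R[i]) := forall m n : int, q ^ m * v <> q ^ n * w.

Definition zeta_nondegenerate :=
  forall (j : 'I_r) (n : int), \prod_i zeta i ^ a i j <> q ^ n.

Definition q_distinct_roots (p p' : {poly R[i]}) :=
  forall v w, root p v -> root p' w -> q_distinct v w.

Definition nondegenerate Qp :=
  [/\ zeta_nondegenerate,
      forall i j k, i != j -> a i k != 0 -> a j k != 0 ->
        [/\ q_distinct_roots (Qp i) (Qp j),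
            q_distinct_roots (Qp i) (Lambda k)
          & q_distinct_roots (Qp j) (Lambda k)],
      r = 1%N -> forall i, q_distinct_roots (Qp i) (Lambda i)
    & forall i, Qp i \is monic].

Definition xi_tilde (i : 'I_r) : R[i] :=
  zeta i * \prod_(j | prec i j) zeta j ^ a j i.

Definition xi (i : 'I_r) : R[i] :=
  (zeta i)^-1 * \prod_(j | prec j i) zeta j ^ (- a j i).

Definition qshift (p : {poly R[i]}) : {poly R[i]} := p \Po (q *: 'X).

(* The exponents - a j i below are nonnegative since i != j. *)
Definition QQ_system Qp Qm := forall i,
  xi_tilde i *: (Qm i * qshift (Qp i)) - xi i *: (qshift (Qm i) * Qp i)
  = Lambda i * \prod_(j | prec i j) qshift (Qp j) ^ (- a j i)
             * \prod_(j | prec j i) Qp j ^ (- a j i).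

(* Division by 0 is total in the library, so that the denominators have to be
   required not to vanish. *)
Definition Bethe_equations Qp := forall i w, root (Qp i) w ->
  let den := (Lambda i).[q^-1 * w]
             * \prod_(j | prec i j) (Qp j).[w] ^ (- a j i)
             * \prod_(j | prec j i) (Qp j).[q^-1 * w] ^ (- a j i) in
  [/\ (Qp i).[q^-1 * w] != 0, den != 0
    & (Qp i).[q * w] / (Qp i).[q^-1 * w] * \prod_j zeta j ^ a j i
      = - ((Lambda i).[w]
           * \prod_(j | prec i j) (Qp j).[q * w] ^ (- a j i)
           * \prod_(j | prec j i) (Qp j).[w] ^ (- a j i) / den)].

(* The roots of Qp i are w_i^1, ..., w_i^(m_i), pairwise distinct, where m_i is
   the degree of Qp i. *)
Definition simple_roots Qp := forall i,
  exists2 s : seq R[i], uniq s & Qp i = \prod_(w <- s) ('X - w%:P).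

Definition QQ_solutions
    : set (('I_r -> {poly R[i]}) * ('I_r -> {poly R[i]})) :=
  [set Q | nondegenerate Q.1 /\ QQ_system Q.1 Q.2]%classic.

Definition Bethe_solutions : set ('I_r -> {poly R[i]}) :=
  [set Qp | nondegenerate Qp /\ Bethe_equations Qp]%classic.

End QQ.

(* Main.v *)
(* Write P = Q^i_+ and F for the right-hand side of the i-th QQ-equation.
   Evaluating that equation at w and q^-1 w, for a root w of P, kills one term
   each time and expresses Q^i_-(w) in two ways; eliminating it gives the Bethe
   equation, since xi_tilde_i / xi_i = prod_j zeta_j^(a_ji).  Comparing leading
   coefficients in D(z) P(qz) xi_tilde_i = D(qz) P(z) xi_i shows that Q^i_- is
   unique, because this ratio is not a power of q.  Conversely, if the roots of
   P are simple, interpolate D0(w) = F(w) / (xi_tilde_i P(qw)).  By the Bethe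
   equations the defect of D0 vanishes at all w and q^-1 w, so it equals
   L(z) P(z) P(qz), and D0 + P E solves the QQ-equation as soon as
   xi_tilde_i E(z) - xi_i E(qz) = L(z), which is solved coefficientwise. *)
Require Import Defs.
From mathcomp Require Import all_boot all_order all_algebra.
From mathcomp Require Import boolp classical_sets functions reals.
From mathcomp Require Import complex.
From mathcomp Require Import ring.

Set Implicit Arguments.
Unset Strict Implicit.
Unset Printing Implicit Defensive.

Import Order.TTheory GRing.Theory Num.Theory.
Local Open Scope ring_scope.
Local Open Scope classical_set_scope.

(** * First-order linear q-difference equations for polynomials over a field *)

Section QDifference.

Variables (F : fieldType) (q : F).
Hypothesis q_neq0 : q != 0.

Local Notation qs p := (p \Po (q *: 'X)).

Lemma horner_comp_scaleX (c x : F) (p : {poly F}) :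
  (p \Po (c *: 'X)).[x] = p.[c * x].
Proof. by rewrite horner_comp hornerZ hornerX. Qed.

Lemma coef_comp_scaleX (c : F) (p : {poly F}) k :
  (p \Po (c *: 'X))`_k = c ^+ k * p`_k.
Proof.
rewrite comp_polyE coef_sum.
under eq_bigr do rewrite exprZn scalerA coefZ coefXn.
case: (ltnP k (size p)) => kp.
  rewrite (bigD1 (Ordinal kp)) //= eqxx mulr1 big1 ?addr0 1?mulrC // => i ik.
  by rewrite eq_sym -[k]/(val (Ordinal kp)) (inj_eq val_inj) (negPf ik) mulr0.
rewrite [p`_k]nth_default // mulr0 big1 // => i _.
by rewrite eq_sym ltn_eqF ?mulr0 // (leq_trans (ltn_ord i)).
Qed.

Lemma lead_coef_comp_scaleX (p : {poly F}) :
  lead_coef (qs p) = q ^+ (size p).-1 * lead_coef p.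
Proof.
rewrite /lead_coef size_comp_poly2 ?coef_comp_scaleX //.
by rewrite size_scale ?size_polyX.
Qed.

Lemma interpolation (s : seq F) (f : F -> F) : uniq s ->
  exists p : {poly F}, {in s, forall w, p.[w] = f w}.
Proof.
elim: s => [_|x s IHs /= /andP[xs /IHs[p pE]]]; first by exists 0.
pose m : {poly F} := \prod_(w <- s) ('X - w%:P).
have mx : m.[x] != 0 by rewrite -rootE root_prod_XsubC.
(* Newton step: the correction is a multiple of [m], which vanishes at the earlier nodes but not at
   [x]. *)
exists (p + ((f x - p.[x]) / m.[x]) *: m) => w.
rewrite inE hornerD hornerZ => /predU1P[->|ws].
  by rewrite divfK // addrC subrK.
have /rootP -> : root m w by rewrite root_prod_XsubC.
by rewrite mulr0 addr0 pE.
Qed.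

Variables al be : F.

Lemma qdiff_inj (P D : {poly F}) : be != 0 ->
  (forall n : int, al / be != q ^ n) -> P != 0 ->
  al *: (D * qs P) - be *: (qs D * P) = 0 -> D = 0.
Proof.
move=> be0 albe P0 /eqP; rewrite subr_eq0 => /eqP /(congr1 lead_coef).
rewrite !lead_coefZ !lead_coefM !lead_coef_comp_scaleX => E.
apply/eqP/negPn/negP => D0.
(* For [D] nonzero, [E] forces [al / be] to be q to the power deg D - deg P. *)
have /negP[] := albe ((size D).-1%:Z - (size P).-1%:Z).
have dp0 : lead_coef D * lead_coef P != 0 by rewrite mulf_neq0 // lead_coef_eq0.
rewrite expfzDr // -exprnP -exprnN eqr_div ?expf_neq0 //.
apply/eqP/(mulIf dp0); apply: etrans (etrans E _); ring.
Qed.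

(** The operator is diagonal on monomials, with eigenvalue [al - be * q ^+ k] on ['X^k]. *)
Lemma qdiff_scalar_surj (G : {poly F}) :
  (forall k : nat, al != be * q ^+ k) ->
  exists E : {poly F}, al *: E - be *: qs E = G.
Proof.
move=> albe; exists (\poly_(k < size G) (G`_k / (al - be * q ^+ k))).
apply/polyP => k; rewrite coefB !coefZ coef_comp_scaleX coef_poly.
case: ltnP => kG; last by rewrite !mulr0 subr0 nth_default.
by rewrite [be * (_ * _)]mulrA -mulrBl mulrC divfK // subr_eq0.
Qed.

(** The last hypothesis is the Bethe equation cleared of denominators, [G] being the right-hand side
    of the QQ-equation. *)
Lemma qdiff_surj (s : seq F) (G : {poly F}) :
  let P := \prod_(w <- s) ('X - w%:P) in
  uniq s -> al != 0 -> (forall k : nat, al != be * q ^+ k) ->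
  {in s, forall w, P.[q^-1 * w] != 0} ->
  {in s, forall w,
     be * P.[q^-1 * w] * G.[w] = - (al * P.[q * w] * G.[q^-1 * w])} ->
  exists D : {poly F}, al *: (D * qs P) - be *: (qs D * P) = G.
Proof.
move=> P us al0 albe Pq GE.
have Ps w : w \in s -> P.[w] = 0.
  by move=> ws; apply/rootP; rewrite root_prod_XsubC.
have Pq' w : w \in s -> P.[q * w] != 0.
  (* If [q * w] were a root too, [Pq] at [q * w] would give [P.[w] != 0]. *)
  move=> ws; apply: contraTneq (ws) => /rootP; rewrite root_prod_XsubC => /Pq.
  by rewrite mulKf // Ps // eqxx.
have [D0 D0E] := interpolation (fun w => G.[w] / (al * P.[q * w])) us.
pose H := G - (al *: (D0 * qs P) - be *: (qs D0 * P)).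
have HE x : H.[x] = G.[x] - (al * (D0.[x] * P.[q * x])
    - be * (D0.[q * x] * P.[x])).
  by rewrite /H !hornerE !horner_comp_scaleX.
have H1 w : w \in s -> H.[w] = 0.
  move=> ws; rewrite HE D0E // (Ps w) //; field.
  by rewrite al0 Pq'.
have H2 w : w \in s -> H.[q^-1 * w] = 0.
  move=> ws; rewrite HE mulVKf // (Ps w) // (D0E w) //.
  (* Multiplying by the denominator of [D0.[w]] turns the claim into [GE]. *)
  have k0 : al * P.[q * w] != 0 by rewrite mulf_neq0 // Pq'.
  apply: (mulfI k0); rewrite [RHS]mulr0.
  transitivity (al * P.[q * w] * G.[q^-1 * w] + be * P.[q^-1 * w] * G.[w]).
    by field; rewrite al0 Pq'.
  by rewrite GE // subrr.
have [K HK] : exists K, H = K * P.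
  apply: uniq_roots_prod_XsubC; rewrite ?uniq_rootsE //.
  by apply/allP => w /H1/rootP.
(* [H] vanishes at [q^-1 * w] while [P] does not, so the cofactor [K] vanishes there; substituting
   [q *: 'X] then makes [qs P] a factor of [K]. *)
have [L KL] : exists L, K \Po (q^-1 *: 'X) = L * P.
  apply: uniq_roots_prod_XsubC; rewrite ?uniq_rootsE //.
  apply/allP => w ws; apply/rootP; rewrite horner_comp_scaleX.
  by apply: (mulIf (Pq _ ws)); rewrite mul0r -hornerM -HK H2.
have {}KL : K = qs L * qs P.
  rewrite -comp_polyM -KL -comp_polyA comp_polyZ comp_polyX scalerA mulVf //.
  by rewrite scale1r comp_polyXr.
have [E EE] := qdiff_scalar_surj (qs L) albe.
(* Adding [P * E] to [D0] changes the left-hand side by [(al *: E - be *: qs E) * P * qs P], which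
   is exactly the defect [H]. *)
exists (D0 + P * E); apply/eqP; rewrite -subr_eq0 -oppr_eq0 opprB; apply/eqP.
transitivity (H - (al *: E - be *: qs E) * P * qs P).
  rewrite /H comp_polyD comp_polyM -!mul_polyC; ring.
by rewrite EE HK KL; ring.
Qed.

End QDifference.

(** * Diagonal entries and neighbours in a Cartan matrix *)

Section CartanMatrix.

Variables (R : realType) (r : nat) (a : 'M[int]_r).
Hypothesis a_cartan : simple_cartan_matrix R a.

Lemma cartan_diag i : a i i = 2.
Proof.
case: a_cartan => _ [alpha alphaU aE] _ _.
apply: (@intr_inj R).
(* Cancelling requires [alpha_i] to have nonzero norm: otherwise row [i] of [alpha] is zero,
   contradicting invertibility. *)
rewrite aE mulfK //; apply/negP => /eqP.
rewrite mxE; under eq_bigr do rewrite mxE.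
move/psumr_eq0P => /= z.
have row0 : row i alpha = 0.
  apply/rowP => k; rewrite !mxE; apply/eqP.
  by rewrite -sqrf_eq0 expr2 z // => j _; rewrite -expr2 sqr_ge0.
have := oner_neq0 R.
have : (alpha *m invmx alpha) i i = 1 by rewrite mulmxV // mxE eqxx.
have -> : (alpha *m invmx alpha) i i = (row i alpha *m invmx alpha) 0 i.
  by rewrite -row_mul !mxE.
by rewrite row0 mul0mx mxE => <-; rewrite eqxx.
Qed.

(** Indecomposability applied to the complement of [i]. For [r != 1], nondegeneracy speaks only of
    pairs of distinct indices, and [j] supplies the second one. *)
Lemma cartan_neighbour i : r != 1%N -> exists2 j, j != i & a j i != 0.
Proof.
move=> r1; case: a_cartan => r0 _ _ /(_ [set~ i]%SET).
have := cardsC1 i; rewrite card_ord => ->.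
have -> : (0 < r.-1 < r)%N.
  by rewrite ltn_predL r0 andbT -ltnS prednK // ltn_neqAle eq_sym r1 r0.
case=> // j [k [ji]]; rewrite !inE negbK in ji * => /eqP -> aji.
by exists j.
Qed.

End CartanMatrix.

(** * Passage between the QQ-system and the Bethe equations *)

Section QQSystem.

Variables (R : realType) (r : nat) (a : 'M[int]_r) (prec : rel 'I_r).
Variables (q : R[i]) (zeta : 'I_r -> R[i]) (Lambda : 'I_r -> {poly R[i]}).
Hypothesis a_cartan : simple_cartan_matrix R a.
Hypothesis prec_order : strict_total_order prec.
Hypothesis q_neq0 : q != 0.
Hypothesis zeta_neq0 : forall i, zeta i != 0.
Hypothesis zeta_nondeg : zeta_nondegenerate a q zeta.

Implicit Types (Qp Qm : 'I_r -> {poly R[i]}).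

Local Notation xit := (xi_tilde a prec zeta).
Local Notation xi := (xi a prec zeta).

Definition QQ_rhs Qp i : {poly R[i]} :=
  Lambda i * \prod_(j | prec i j) qshift q (Qp j) ^ (- a j i)
           * \prod_(j | prec j i) Qp j ^ (- a j i).

Lemma prec_irr : irreflexive prec. Proof. by case: prec_order. Qed.

Lemma cartan_offdiag_exp i j : i != j -> exists n : nat, - a i j = n%:Z.
Proof.
case: a_cartan => _ _ le0 _ /le0; rewrite -oppr_ge0.
by case: (- a i j) => // n _; exists n.
Qed.

(** A negative power of a non-unit polynomial is a default value that evaluation need not respect;
    off the diagonal the exponent is a natural number. *)
Lemma horner_exprz_offdiag i j (p : {poly R[i]}) x : i != j ->
  (p ^ (- a i j)).[x] = p.[x] ^ (- a i j).
Proof. by move=> /cartan_offdiag_exp[n ->]; rewrite -!exprnP horner_exp. Qed.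

Lemma horner_QQ_rhs Qp i x : (QQ_rhs Qp i).[x] =
  (Lambda i).[x] * \prod_(j | prec i j) (Qp j).[q * x] ^ (- a j i)
                 * \prod_(j | prec j i) (Qp j).[x] ^ (- a j i).
Proof.
rewrite /QQ_rhs !hornerM !horner_prod; congr (_ * _ * _).
  apply: eq_bigr => j ij; rewrite horner_exprz_offdiag ?horner_comp_scaleX //.
  by apply: contraTneq ij => ->; rewrite prec_irr.
apply: eq_bigr => j ji; rewrite horner_exprz_offdiag //.
by apply: contraTneq ji => ->; rewrite prec_irr.
Qed.

Lemma xit_neq0 i : xit i != 0.
Proof.
by rewrite mulf_neq0 //; apply/prodf_neq0 => j _; rewrite expfz_neq0.
Qed.

Lemma xi_neq0 i : xi i != 0.
Proof.
by rewrite mulf_neq0 ?invr_eq0 //; apply/prodf_neq0 => j _; rewrite expfz_neq0.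
Qed.

(** The two factors [zeta i] account for [a i i = 2]; totality of the order splits the other indices
    between [xi_tilde] and the inverse of [xi]. *)
Lemma xi_ratio i : xit i / xi i = \prod_j zeta j ^ a j i.
Proof.
case: prec_order => irr trans tot.
rewrite (bigD1 i) //= (bigID (prec i)) /= (cartan_diag a_cartan) mulrA.
have -> : \prod_(j | (j != i) && prec i j) zeta j ^ a j i =
          \prod_(j | prec i j) zeta j ^ a j i.
  apply: eq_bigl => j; case: eqVneq => [->|//]; by rewrite irr.
have -> : \prod_(j | (j != i) && ~~ prec i j) zeta j ^ a j i =
          \prod_(j | prec j i) zeta j ^ a j i.
  apply: eq_bigl => j; case: eqVneq => [->|ji] /=; first by rewrite irr.
  apply/idP/idP => [nij|pji].
    by have := tot _ _ ji; rewrite (negPf nij) orbF.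
  by apply/negP => /(trans _ _ _ pji); rewrite irr.
rewrite /xi_tilde /Defs.xi.
under [X in _ / (_ * X)]eq_bigr do rewrite -invr_expz.
rewrite prodfV invfM !invrK -exprnP expr2; ring.
Qed.

Lemma xi_ratio_neq i (n : int) : xit i / xi i != q ^ n.
Proof. by rewrite xi_ratio; apply/eqP/zeta_nondeg. Qed.

Lemma q_distinct_roots_neq0 (p p' : {poly R[i]}) w (n : int) :
  q_distinct_roots q p p' -> root p w -> p'.[q ^ n * w] != 0.
Proof.
move=> pp' pw; apply/negP => p'w.
by apply: (pp' _ _ pw p'w n 0); rewrite expr0z mul1r.
Qed.

(** Nondegeneracy with [k = i] handles the factors with [a j i != 0]; the others have exponent 0 and
    equal 1. *)
Lemma QQ_rhs_neq0 Qp i w : Defs.nondegenerate a q zeta Lambda Qp ->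
  root (Qp i) w -> (QQ_rhs Qp i).[q^-1 * w] != 0.
Proof.
move=> [_ nd nd1 _] rw.
have aii : a i i != 0 by rewrite (cartan_diag a_cartan).
have Q_neq0 j (n : int) : i != j -> (Qp j).[q ^ n * w] ^ (- a j i) != 0.
  move=> ij; have [->|aji] := eqVneq (a j i) 0; first by rewrite oppr0 oner_neq0.
  have [QQ _ _] := nd _ _ _ ij aii aji.
  by rewrite expfz_neq0 // (q_distinct_roots_neq0 _ QQ).
rewrite horner_QQ_rhs mulVKf // -exprN1 !mulf_neq0 //.
- apply: q_distinct_roots_neq0 rw; have [r1|r1] := eqVneq r 1%N; first exact: nd1.
  have [j ji aji] := cartan_neighbour a_cartan i r1.
  by have [] := nd _ _ i ji aji aii.
- apply/prodf_neq0 => j ij; rewrite -[w]mul1r -(expr0z q); apply: Q_neq0.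
  by apply: contraTneq ij => <-; rewrite prec_irr.
- apply/prodf_neq0 => j ij; apply: Q_neq0.
  by apply: contraTneq ij => <-; rewrite prec_irr.
Qed.

Lemma QQ_horner Qp Qm i x : QQ_system a prec q zeta Lambda Qp Qm ->
  (QQ_rhs Qp i).[x] = xit i * ((Qm i).[x] * (Qp i).[q * x])
                    - xi i * ((Qm i).[q * x] * (Qp i).[x]).
Proof. by move=> QQ; rewrite -[QQ_rhs Qp i]QQ !hornerE !horner_comp_scaleX. Qed.

Lemma QQ_Bethe Qp Qm : Defs.nondegenerate a q zeta Lambda Qp ->
  QQ_system a prec q zeta Lambda Qp Qm ->
  Bethe_equations a prec q zeta Lambda Qp.
Proof.
move=> nd QQ i w rw; have den0 := QQ_rhs_neq0 nd rw.
have e1 := QQ_horner i w QQ; have e2 := QQ_horner i (q^-1 * w) QQ.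
move: e1 e2; rewrite !mulVKf // (rootP rw) !mulr0 subr0 sub0r => e1 e2.
have xi0 := xi_neq0 i; have := den0.
(* Nonvanishing of the right-hand side at [q^-1 * w] yields both [(Qp i).[q^-1 * w] != 0] and [(Qm
   i).[w] != 0], so [(Qm i).[w]] can be cancelled. *)
rewrite e2 oppr_eq0 mulf_eq0 negb_or => /andP[_].
rewrite mulf_eq0 negb_or => /andP[Qm0 Qp0].
have denE := horner_QQ_rhs Qp i (q^-1 * w); rewrite mulVKf // in denE.
rewrite -denE -xi_ratio -horner_QQ_rhs; split => //.
by rewrite e1 e2; field; rewrite Qp0 xi0 Qm0.
Qed.

Lemma QQ_unique Qp Qm Qm' : (forall i, Qp i \is monic) ->
  QQ_system a prec q zeta Lambda Qp Qm ->
  QQ_system a prec q zeta Lambda Qp Qm' -> Qm = Qm'.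
Proof.
move=> mon QQ QQ'; apply/funext => i; apply/eqP; rewrite -subr_eq0; apply/eqP.
apply: (@qdiff_inj _ q q_neq0 (xit i) (xi i) (Qp i)).
- exact: xi_neq0.
- exact: xi_ratio_neq.
- exact: monic_neq0.
(* The difference of the two solutions satisfies the homogeneous equation. *)
have := etrans (QQ i) (esym (QQ' i)).
move=> /eqP; rewrite -subr_eq0 => /eqP <-.
by rewrite /qshift comp_polyB -!mul_polyC; ring.
Qed.

Lemma Bethe_QQ Qp : simple_roots Qp ->
  Bethe_equations a prec q zeta Lambda Qp ->
  exists Qm, QQ_system a prec q zeta Lambda Qp Qm.
Proof.
move=> simple Bethe.
(* With [Qp] given, the equations decouple: the [i]-th one involves only [Qm i]. *)
suff /choice[Qm QmE] : forall i, exists D : {poly R[i]},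
    xit i *: (D * qshift q (Qp i)) - xi i *: (qshift q D * Qp i) = QQ_rhs Qp i.
  by exists Qm.
move=> i; have [s us PE] := simple i.
rewrite PE; apply: qdiff_surj => //; rewrite -?PE.
- exact: xit_neq0.
- move=> k; apply: contraNneq (xi_ratio_neq i k) => ->.
  by rewrite mulrC mulKf ?xi_neq0.
- by move=> w; rewrite -root_prod_XsubC -PE => /Bethe[].
- move=> w; rewrite -root_prod_XsubC -PE => /Bethe[].
  have denE := horner_QQ_rhs Qp i (q^-1 * w); rewrite mulVKf // in denE.
  rewrite -denE -xi_ratio -horner_QQ_rhs => Q0 d0 E.
  have x0 := xi_neq0 i.
  have k0 : (Qp i).[q^-1 * w] * xi i * (QQ_rhs Qp i).[q^-1 * w] != 0.
    exact: mulf_neq0 (mulf_neq0 Q0 x0) d0.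
  transitivity (- ((Qp i).[q^-1 * w] * xi i * (QQ_rhs Qp i).[q^-1 * w]) *
     - ((QQ_rhs Qp i).[w] / (QQ_rhs Qp i).[q^-1 * w])); first by field.
  by rewrite -E; field; rewrite x0.
Qed.

End QQSystem.

Theorem theorem6p4 (R : realType) (r : nat) (a : 'M[int]_r) (prec : rel 'I_r)
    (q : R[i]) (zeta : 'I_r -> R[i]) (Lambda : 'I_r -> {poly R[i]})
    (a_cartan : simple_cartan_matrix R a)
    (prec_order : strict_total_order prec)
    (q_neq0 : q != 0)
    (q_not_root_of_unity : forall n : nat, (0 < n)%N -> q ^+ n != 1)
    (zeta_neq0 : forall i, zeta i != 0)
    (zeta_nondeg : zeta_nondegenerate a q zeta)
    (Lambda_monic : forall i, Lambda i \is monic) :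
  let QQ := QQ_solutions a prec q zeta Lambda in
  let Bethe := Bethe_solutions a prec q zeta Lambda in
  let simple := [set Qp | simple_roots Qp] in
  (* forgetting Q_- maps all solutions of the QQ-system injectively to
     solutions of the Bethe equations, bijectively if the roots are simple *)
  [/\ set_fun QQ Bethe fst, set_inj QQ fst
    & set_bij (QQ `&` [set Q | simple Q.1]) (Bethe `&` simple) fst].
Proof.
move=> QQ Bethe simple.
have QQB : set_fun QQ Bethe fst.
  by move=> [Qp Qm] /= [nd sys]; split=> //; apply: QQ_Bethe sys.
have QQinj : set_inj QQ fst.
  move=> [Qp Qm] [Qp' Qm'] /set_mem[/= nd sys] /set_mem[/= _ sys'] E.
  rewrite -E in sys' *; congr pair.
  by case: (nd) => _ _ _ mon; apply: QQ_unique sys sys'.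
split=> //; split.
- by move=> Q [/QQB].
- by move=> Q Q' /set_mem[QQQ _] /set_mem[QQQ' _]; apply: QQinj; rewrite inE.
(* Surjectivity is where simplicity enters: the roots serve as distinct interpolation nodes. *)
- move=> Qp [[nd B] sim].
  have [Qm QmE] := Bethe_QQ a_cartan prec_order q_neq0 zeta_neq0 zeta_nondeg sim B.
  by exists (Qp, Qm).
Qed.
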